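(* Consider the two-stage stochastic linear program and the inexact regularized L-shaped algorithm described in the context, with descent parameter $\beta\in(0,1)$. Suppose: (i) $X$ is non-empty and bounded with diameter $D$, i.e. $\|x-\bar x\|\le D$ for all $x,\bar x\in X$; (ii) there are $\epsilon_1,\epsilon_2$ such that for every outer iteration $k$ and all $x\in X$, $\hat f_k(x)\in[f(x)-\epsilon_1,f(x)+\epsilon_2]$; (iii) there is $G>0$ such that $\|\hat g_k(x)\|\le G$ for every outer iteration $k$ and all $x\in X$; (iv) for all $k\ge 0$ and $0\le t\le T_k-2$, the bundle function $f_{k,t+1}:\mathbb{R}^n\to\mathbb{R}$ is convex, $G$-Lipschitz continuous, and for all $x\in\mathbb{R}^n$ $$\hat f_k(x)\ge f_{k,t+1}(x)\ge\max\{\hat f_k(x_{k,t+1})+\hat g_k(x_{k,t+1})^T(x-x_{k,t+1}),\ f_{k,t}(x_{k,t+1})+s_{k,t+1}^T(x-x_{k,t+1})\},$$ where $s_{k,t+1}=\rho_k(x_{k,0}-x_{k,t+1})$; (v) $f$ is $\mu$-sharp for some $\mu>0$, i.e. $f(x)-f^*\ge\mu\cdot\mathrm{dist}(x,X^* )$ for all $x\in X$. Let $\bar\epsilon=(\beta+1)(\epsilon_1+\epsilon_2)$, assumed to lie in $(0,1)$. Suppose the algorithm uses the step-sizes $$\rho_k=\frac{\mu^2}{\hat f_k(x_{k,0})-\epsilon_2-f^*}>0\qquad\text{for all }k\ge0.$$ Define $$\delta^{SI}:=\frac{4\bar\epsilon}{\beta},\qquad K^{SI}:=\max\left\{0,\left\lceil-\log_{(1-\frac\beta2)}\left(\frac{f(x_{0,0})-f^*-\frac{3\bar\epsilon}{\beta}}{\frac{\bar\epsilon}{\beta}}\right)\right\rceil\right\}=\mathcal{O}\left(\log\left(\frac1{\bar\epsilon}\right)\right)$$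 (with $K^{SI}=0$ if $f(x_{0,0})-f^*\le 3\bar\epsilon/\beta$). Then there exists an outer iteration $k\le K^{SI}$ such that $f(x_{k,0})-f^*\le\delta^{SI}$. Furthermore, the total number of bundle steps, i.e. inner steps (including null steps), before such a solution is found is at most $$\left(\frac{16G^2}{(1-\beta)^2\mu^2\left(1-\frac{2\beta}{3(\beta+1)}\right)}\right)\cdot K^{SI}=\mathcal{O}\left(\log\left(\frac1{\bar\epsilon}\right)\right).$$
   Context: Problem. $\min_{x\in X} f(x):=c^Tx+\mathbb{E}_\xi[Q(x;\xi)]$ with $X=\{x\in\mathbb{R}^n: Ax=b,\ x\ge0\}$ and $Q(x;\xi)=\min_{y\in\mathbb{R}^l}\{q(\xi)^Ty: T(\xi)x+Wy=h(\xi),\ y\ge0\}$, where $A\in\mathbb{R}^{m\times n}$, $b\in\mathbb{R}^m$, $c\in\mathbb{R}^n$, $W\in\mathbb{R}^{r\times l}$ (not depending on $\xi$) and $(T(\xi),q(\xi),h(\xi))\in\mathbb{R}^{r\times n}\times\mathbb{R}^l\times\mathbb{R}^r$. The function $f:X\to\mathbb{R}$ is real-valued and convex, $f^*=\min_{x\in X}f(x)$, $X^*=\{x\in X: f(x)=f^*\}$ is the optimal solution set, and $\mathrm{dist}(x,X^* )=\min_{x^*\in X^*}\|x-x^*\|$. $\|\cdot\|$ is the Euclidean norm. Estimates. For $x\in X$, $U(x;\xi)$ denotes a chosen element of $\arg\max_{u\in\mathbb{R}^r}\{u^T(h(\xi)-T(\xi)x): W^Tu\le q(\xi)\}$. Given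 a finite set $S_k$ of samples $\xi_i$ of $\xi$, $$\hat f_k(x)=c^Tx+\frac1{|S_k|}\sum_{i\in S_k}Q(x;\xi_i),\qquad \hat g_k(x)=c-\frac1{|S_k|}\sum_{i\in S_k}T(\xi_i)^TU(x;\xi_i)\in\partial\hat f_k(x).$$ Algorithm (inexact regularized L-shaped algorithm). Input: $x_{0,0}\in X$, step-sizes $\rho_k>0$, $\beta\in(0,1)$. For each outer iteration $k=0,1,2,\dots$: draw a sample set $S_k$, form $\hat f_k,\hat g_k$, and set $f_{k,0}(x)=\hat f_k(x_{k,0})+\hat g_k(x_{k,0})^T(x-x_{k,0})$. For each inner iteration $t=0,1,2,\dots$: compute $x_{k,t+1}=\arg\min_{x\in X}\{f_{k,t}(x)+\frac{\rho_k}{2}\|x-x_{k,0}\|^2\}$. If $$\beta(\hat f_k(x_{k,0})-f_{k,t}(x_{k,t+1}))\le\hat f_k(x_{k,0})-\hat f_k(x_{k,t+1}),$$ then (serious step) set $T_k=t+1$, $x_{k+1,0}=x_{k,t+1}$, and go to outer iteration $k+1$. Otherwise (null step) form a new bundle function $$f_{k,t+1}(x)=\max\Big\{\max_{j\in J^g_{k,t+1}}\{\hat f_k(x_{k,j})+\hat g_k(x_{k,j})^T(x-x_{k,j})\},\ \max_{j\in J^s_{k,t+1}}\{f_{k,j-1}(x_{k,j})+s_{k,j}^T(x-x_{k,j})\}\Big\},$$ with index sets $J^g_{k,t+1}\subseteq\{0,\dots,t+1\}$, $J^s_{k,t+1}\subseteq\{1,\dots,t+1\}$ and $s_{k,j}=\rho_k(x_{k,0}-x_{k,j})$,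 and continue with $t+1$. ($T_k=\infty$ if the inner loop never terminates.) Counting. An inner step is one inner iteration (the computation of one point $x_{k,t+1}$). If $k$ is the first outer iteration for which $x_{k,0}$ has the required accuracy, the number of inner steps before such a solution is found is $\sum_{j<k}T_j$. *)

(* Defs.v *)
From HB Require Import structures.
From mathcomp Require Import all_boot all_order all_algebra.
From mathcomp Require Import all_classical all_reals all_analysis.

Set Implicit Arguments.
Unset Strict Implicit.
Unset Printing Implicit Defensive.

Import Order.TTheory GRing.Theory Num.Theory.
Import numFieldNormedType.Exports.

Local Open Scope classical_set_scope.
Local Open Scope ring_scope.

Section euclidean.
Context {R : realType}.

Definition dot n (u v : 'cV[R]_n) : R := (u^T *m v) 0 0.

(* The library norm on matrices is the sup norm, hence this definition. *)
Definition enorm n (u : 'cV[R]_n) : R := Num.sqrt (dot u u).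

Definition lev n (u v : 'cV[R]_n) : Prop := forall i, u i 0 <= v i 0.

Definition is_argmin n (X : set 'cV[R]_n) (phi : 'cV[R]_n -> R)
    (y : 'cV[R]_n) : Prop :=
  X y /\ forall z, X z -> phi y <= phi z.

Definition is_argmax n (X : set 'cV[R]_n) (phi : 'cV[R]_n -> R)
    (y : 'cV[R]_n) : Prop :=
  X y /\ forall z, X z -> phi z <= phi y.

Definition dist n (x : 'cV[R]_n) (Y : set 'cV[R]_n) : R :=
  inf [set enorm (x - y) | y in Y].

Definition elipschitz n (G : R) (phi : 'cV[R]_n -> R) : Prop :=
  forall x y, `|phi x - phi y| <= G * enorm (x - y).

End euclidean.

(* Two-stage stochastic linear program; xi ranges over Xi and only T, q and h
   depend on it (fixed recourse W). *)
Record tslp (R : realType) (m n r l : nat) (Xi : Type) := TSLP {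
  lpA : 'M[R]_(m, n);
  lpb : 'cV[R]_m;
  lpc : 'cV[R]_n;
  lpW : 'M[R]_(r, l);
  lpT : Xi -> 'M[R]_(r, n);
  lpq : Xi -> 'cV[R]_l;
  lph : Xi -> 'cV[R]_r }.

Section problem.
Context {R : realType} {m n r l : nat} {d : measure_display}
  {Xi : measurableType d}.
Variable pb : tslp R m n r l Xi.

Definition feasible : set 'cV[R]_n :=
  [set x | lpA pb *m x = lpb pb /\ lev 0 x].

Definition recourse_set (x : 'cV[R]_n) (xi : Xi) : set 'cV[R]_l :=
  [set y | lpT pb xi *m x + lpW pb *m y = lph pb xi /\ lev 0 y].

(* Optimal value of the second-stage program: +oo if it is infeasible, -oo if
   it is unbounded below; in all other cases a linear program attains its
   infimum. *)
Definition recourse (x : 'cV[R]_n) (xi : Xi) : \bar R :=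
  ereal_inf [set (dot (lpq pb xi) y)%:E | y in recourse_set x xi].

(* P is the law of xi. The value is meaningful at points x where
   [recourse x] is P-integrable. *)
Definition objective (P : probability Xi R) (x : 'cV[R]_n) : R :=
  dot (lpc pb) x + fine (\int[P]_xi recourse x xi)%E.

Definition optimal_set (P : probability Xi R) (fstar : R) : set 'cV[R]_n :=
  [set x | feasible x /\ objective P x = fstar].

Definition sharp (P : probability Xi R) (fstar mu : R) : Prop :=
  forall x, feasible x ->
    mu * dist x (optimal_set P fstar) <= objective P x - fstar.

Definition dual_set (xi : Xi) : set 'cV[R]_r :=
  [set u | lev ((lpW pb)^T *m u) (lpq pb xi)].

Definition dual_argmax (x : 'cV[R]_n) (xi : Xi) (u : 'cV[R]_r) : Prop :=
  is_argmax (dual_set xi) (fun v => dot v (lph pb xi - lpT pb xi *m x)) u.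

(* A sample set is a list of realizations of xi, so that repeated draws are
   counted with multiplicity. The value is extended real because the sampled
   second-stage programs may be infeasible at x outside the feasible set; the
   case -oo, hence a sum of +oo and -oo, is excluded as soon as the dual sets
   of the samples are nonempty. *)
Definition saa (S : seq Xi) (x : 'cV[R]_n) : \bar R :=
  ((dot (lpc pb) x)%:E +
   ((size S)%:R^-1)%:E * \sum_(xi <- S) recourse x xi)%E.

Definition saa_val (S : seq Xi) (x : 'cV[R]_n) : R := fine (saa S x).

Definition saa_grad (U : 'cV[R]_n -> Xi -> 'cV[R]_r) (S : seq Xi)
    (x : 'cV[R]_n) : 'cV[R]_n :=
  lpc pb - (size S)%:R^-1 *: \sum_(xi <- S) (lpT pb xi)^T *m U x xi.

Definition grad_cut U (S : seq Xi) (y z : 'cV[R]_n) : R :=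
  saa_val S y + dot (saa_grad U S y) (z - y).

End problem.

Section algorithm.
Context {R : realType} {m n r l : nat} {d : measure_display}
  {Xi : measurableType d}.
Variable pb : tslp R m n r l Xi.
Variable U : 'cV[R]_n -> Xi -> 'cV[R]_r.
Variable beta : R.
Variable smp : nat -> seq Xi.
Variable rho : nat -> R.
Variable x : nat -> nat -> 'cV[R]_n.
Variable fb : nat -> nat -> 'cV[R]_n -> R.
(* [T k] is the number of inner steps of outer iteration [k]; [None] stands
   for an inner loop that never terminates. *)
Variable T : nat -> option nat.
Variables Jg Js : nat -> nat -> pred nat.

(* Outer iteration [k] takes place iff all the previous inner loops
   terminate; the data of an iteration not reached are irrelevant. *)
Definition reached (k : nat) : Prop := forall j, (j < k)%N -> T j != None.

Definition lt_steps (t k : nat) : bool :=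
  if T k is Some N then (t < N)%N else true.

Definition total_steps (k : nat) : nat := \sum_(j < k) odflt 0%N (T j).

Definition slope (k j : nat) : 'cV[R]_n := rho k *: (x k 0%N - x k j).

Definition agg_cut (k j : nat) (z : 'cV[R]_n) : R :=
  fb k j.-1 (x k j) + dot (slope k j) (z - x k j).

Definition prox_objective (k t : nat) (z : 'cV[R]_n) : R :=
  fb k t z + rho k / 2 * enorm (z - x k 0%N) ^+ 2.

Definition serious (k t : nat) : Prop :=
  beta * (saa_val pb (smp k) (x k 0%N) - fb k t (x k t.+1)) <=
  saa_val pb (smp k) (x k 0%N) - saa_val pb (smp k) (x k t.+1).

(* The index sets of the bundle function number t are Jg k t, cut down to
   {0, ..., t}, and Js k t, cut down to {1, ..., t}. An empty maximum is -oo,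
   so equality with the real number fb k t z rules out that both are empty. *)
Definition bundle_max (k t : nat) (z : 'cV[R]_n) : \bar R :=
  maxe
    (\big[maxe/-oo%E]_(0 <= j < t.+1 | Jg k t j)
        (grad_cut pb U (smp k) (x k j) z)%:E)
    (\big[maxe/-oo%E]_(1 <= j < t.+1 | Js k t j) (agg_cut k j z)%:E).

Record lshaped_run : Prop := LshapedRun {
  run_init : feasible pb (x 0%N 0%N);
  run_sample : forall k, reached k -> smp k != [::];
  run_rho : forall k, reached k -> 0 < rho k;
  run_T_gt0 : forall k, reached k -> lt_steps 0 k;
  run_fb0 : forall k, reached k ->
    forall z, fb k 0%N z = grad_cut pb U (smp k) (x k 0%N) z;
  run_prox : forall k t, reached k -> lt_steps t k ->
    is_argmin (feasible pb) (prox_objective k t) (x k t.+1);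
  run_serious : forall k t, reached k -> T k = Some t.+1 ->
    serious k t /\ x k.+1 0%N = x k t.+1;
  run_null : forall k t, reached k -> lt_steps t.+1 k ->
    ~ serious k t /\ forall z, (fb k t.+1 z)%:E = bundle_max k t.+1 z }.

Definition bundle_assumption (G : R) : Prop :=
  forall k t, reached k -> lt_steps t.+1 k ->
    [/\ convex_function setT (fb k t.+1 : convex_lmodType 'cV[R]_n -> R^o),
        elipschitz G (fb k t.+1) &
        forall z,
          ((fb k t.+1 z)%:E <= saa pb (smp k) z)%E /\
          Num.max (grad_cut pb U (smp k) (x k t.+1) z) (agg_cut k t.+1 z)
            <= fb k t.+1 z].

End algorithm.

Section rates.
Context {R : realType}.

Definition delta_SI (beta ebar : R) : R := 4 * ebar / beta.

Definition logb (b y : R) : R := ln y / ln b.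

(* [gap0] is the initial gap f(x_{0,0}) - f^*. *)
Definition K_SI (beta gap0 ebar : R) : int :=
  if gap0 <= 3 * ebar / beta then 0
  else Num.max 0
    (Num.ceil (- logb (1 - beta / 2)
                 ((gap0 - 3 * ebar / beta) / (ebar / beta)))).

Definition steps_SI (G mu beta gap0 ebar : R) : R :=
  16 * G ^+ 2 /
    ((1 - beta) ^+ 2 * mu ^+ 2 * (1 - 2 * beta / (3 * (beta + 1))))
  * (K_SI beta gap0 ebar)%:~R.

End rates.

(* Main.v *)
(* In one proximal step from x0 = x_{k,0} write E for fhat(x0) - eps2 - f^*, and
   D for the true gap f(x0) - f^*, so that E <= D <= E + eps1 + eps2. Moving from
   x0 towards X^* by the fraction (E/D)^2 and using sharpness and
   rho = mu^2 / E shows that the proximal gap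
   v_t = fhat(x0) - min_X (f_t + rho/2 |. - x0|^2) is at least E^3 / (2 D^2).
   A serious step decreases fhat by at least beta v_t, which yields
   D_{k+1} <= (1 - beta/2) D_k + 3 ebar / 2 and hence K^SI. A null step gives
   v_{t+1} <= v_t - a v_t^2 with a = (1 - beta)^2 rho / (8 G^2), so that
   a (t + 1) v_t <= 1; together with the lower bound on v_t this bounds the
   length of each inner loop.
   That the initial cut of an outer iteration minorizes fhat rests on strong LP
   duality, deduced from Farkas' lemma. *)
Require Import Defs.
From HB Require Import structures.
From mathcomp Require Import all_boot all_order all_algebra.
From mathcomp Require Import all_classical all_reals all_analysis.
From mathcomp Require Import ring lra.

Set Implicit Arguments.
Unset Strict Implicit.
Unset Printing Implicit Defensive.

Import Order.TTheory GRing.Theory Num.Theory.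
Import numFieldNormedType.Exports.

Local Open Scope classical_set_scope.
Local Open Scope ring_scope.

(** * Inner product, Euclidean norm and the Cauchy-Schwarz inequality *)

Section dot_theory.
Context {R : realType} {n : nat}.
Implicit Types (u v w : 'cV[R]_n) (a b G : R).

Lemma dotE u v : dot u v = \sum_i u i 0 * v i 0.
Proof. by rewrite /dot mxE; apply: eq_bigr => i _; rewrite mxE. Qed.

Lemma dotC u v : dot u v = dot v u.
Proof. by rewrite !dotE; apply: eq_bigr => i _; rewrite mulrC. Qed.

Lemma dotDr u v w : dot u (v + w) = dot u v + dot u w.
Proof. by rewrite /dot mulmxDr mxE. Qed.

Lemma dotZr a u v : dot u (a *: v) = a * dot u v.
Proof. by rewrite /dot -scalemxAr mxE. Qed.

Lemma dotNr u v : dot u (- v) = - dot u v.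
Proof. by rewrite /dot mulmxN mxE. Qed.

Lemma dotDl u v w : dot (u + v) w = dot u w + dot v w.
Proof. by rewrite dotC dotDr !(dotC w). Qed.

Lemma dotZl a u v : dot (a *: u) v = a * dot u v.
Proof. by rewrite dotC dotZr dotC. Qed.

Lemma dotNl u v : dot (- u) v = - dot u v.
Proof. by rewrite dotC dotNr dotC. Qed.

Definition dot_lin := (dotDl, dotDr, dotNl, dotNr, dotZl, dotZr).

Lemma dot_ge0 u : 0 <= dot u u.
Proof. by rewrite dotE sumr_ge0 // => i _; rewrite -expr2 sqr_ge0. Qed.

Lemma ler_dotl w u v : lev 0 w -> lev u v -> dot u w <= dot v w.
Proof.
move=> w0 uv; rewrite !dotE; apply: ler_sum => i _.
by have := w0 i; rewrite mxE => ?; rewrite ler_wpM2r.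
Qed.

Lemma dot_lincomb a b u v : dot (a *: u + b *: v) (a *: u + b *: v) =
  a ^+ 2 * dot u u + 2 * a * b * dot v u + b ^+ 2 * dot v v.
Proof. by rewrite !dot_lin (dotC u v); ring. Qed.

Lemma enorm_ge0 u : 0 <= enorm u.
Proof. exact: sqrtr_ge0. Qed.

Lemma sqr_enorm u : enorm u ^+ 2 = dot u u.
Proof. by rewrite sqr_sqrtr // dot_ge0. Qed.

Lemma enormZ a u : 0 <= a -> enorm (a *: u) = a * enorm u.
Proof.
by move=> a0; rewrite /enorm !dot_lin mulrA sqrtrM -?expr2 ?sqr_ge0 // sqrtr_sqr ger0_norm.
Qed.

Lemma enorm_dot_le u a : 0 <= a -> enorm u <= a -> dot u u <= a ^+ 2.
Proof. by move=> a0 ua; rewrite -sqr_enorm lerXn2r // nnegrE enorm_ge0. Qed.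

(** Cauchy-Schwarz with the norm of [u] replaced by its bound: expand the square of
    [G *: v - s *: u], with [s] the norm of [v], and divide by [G * s]. *)
Lemma dot_enorm_le u v G : 0 < G -> enorm u <= G -> dot u v <= G * enorm v.
Proof.
move=> G0 uG; have uu := enorm_dot_le (ltW G0) uG.
set s := enorm v; have s0 : 0 <= s by exact: enorm_ge0.
have vv : dot v v = s ^+ 2 by rewrite sqr_enorm.
have [s_eq0|s_neq0] := eqVneq s 0.
  have v0 i : v i 0 = 0.
    apply/eqP; rewrite -sqrf_eq0 eq_le sqr_ge0 andbT.
    have <- : dot v v = 0 by rewrite vv s_eq0 expr0n.
    by rewrite dotE (bigD1 i) //= -expr2 lerDl sumr_ge0 // => j _; rewrite -expr2 sqr_ge0.
  by rewrite s_eq0 mulr0 dotE big1 // => i _; rewrite v0 mulr0.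
have sgt0 : 0 < s by rewrite lt_neqAle eq_sym s_neq0.
have := dot_ge0 (G *: v - s *: u); rewrite !dot_lin (dotC v u) vv => h.
rewrite -(ler_pM2l (mulr_gt0 G0 sgt0)).
have := ler_wpM2l (sqr_ge0 s) uu; nra.
Qed.

Lemma norm_dot_enorm_le u v G : 0 < G -> enorm u <= G ->
  `|dot u v| <= G * enorm v.
Proof.
move=> G0 uG; rewrite ler_norml dot_enorm_le // andbT lerNl.
have -> : enorm v = enorm (- v) by rewrite /enorm !dot_lin opprK.
by rewrite -dotNr dot_enorm_le.
Qed.

End dot_theory.

(** * Farkas' lemma and strong duality of linear programs *)

Section duality.
Context {R : realType}.

(* Bartl's induction on the number of inequalities: if dropping the first row [a]
   breaks the implication at [w], normalized so that [a *m w = 1], project every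
   functional along [w] so that it vanishes there. *)
Lemma farkas p q (A : 'M[R]_(q, p)) (b : 'rV[R]_p) :
  (forall z : 'cV[R]_p, lev (A *m z) 0 -> (b *m z) 0 0 <= 0) ->
  exists2 u : 'cV[R]_q, lev 0 u & b = u^T *m A.
Proof.
elim: q A b => [|q IH] A b Ab.
  exists 0 => [i|]; first by rewrite mxE.
  rewrite trmx0 mul0mx; apply/rowP => j; rewrite mxE.
  have bE (s : R) : (b *m (s *: delta_mx j 0 : 'cV_p)) 0 0 = s * b 0 j.
    by rewrite -scalemxAr mxE -colE [in LHS]mxE.
  have h s : s * b 0 j <= 0 by rewrite -bE; apply: Ab => -[].
  by have := h 1; have := h (-1); lra.
rewrite -[A](@vsubmxK _ 1 q) in Ab *.
set a := usubmx _ in Ab *; set A' := dsubmx _ in Ab *.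
have [/IH[u u0 ->]|] :=
    pselect (forall z : 'cV[R]_p, lev (A' *m z) 0 -> (b *m z) 0 0 <= 0).
  exists (@col_mx _ 1 q 1 0 u) => [i|].
    rewrite mxE mxE; case: split_ordP => j _; first by rewrite mxE.
    by have := u0 j; rewrite mxE.
  by rewrite (@tr_col_mx _ 1 q 1) (@mul_row_col _ 1 1 q) trmx0 mul0mx add0r.
move=> /existsNP[z0 /not_implyP[A'z0 /negP]]; rewrite -ltNge => bz0.
set s := (a *m z0) 0 0.
have colE z : lev (a *m z) 0 -> lev (A' *m z) 0 ->
    lev (@col_mx _ 1 q p a A' *m z) 0.
  move=> az A'z i; rewrite mul_col_mx mxE [X in _ <= X]mxE.
  by case: split_ordP => j _; [have := az j|have := A'z j]; rewrite [X in _ <= X]mxE.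
(* Otherwise [z0] satisfies every inequality, the first row included, although [b] is positive
   there. *)
have s0 : 0 < s.
  rewrite ltNge; apply/negP => sle; move: bz0; rewrite ltNge => /negP; apply.
  by apply: Ab; apply: colE => // i; rewrite (ord1 i) [X in _ <= X]mxE.
pose w := s^-1 *: z0.
have aw : a *m w = 1%:M.
  rewrite -scalemxAr; apply/matrixP => i j; rewrite !ord1 [LHS]mxE [RHS]mxE eqxx -/s.
  by rewrite mulVf ?gt_eqF.
(* The projected functionals take at [z] the values that the original ones take at
   [y = z - (a z) w], and [a y = 0], so the dropped row holds at [y]. *)
have [|u u0 bE] := IH (A' - (A' *m w) *m a) (b - (b *m w) *m a).
  move=> z h; pose y := z - (a *m z) 0 0 *: w.
  have yE : y = z - w *m (a *m z) by rewrite [a *m z]mx11_scalar mul_mx_scalar.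
  have -> : (b - b *m w *m a) *m z = b *m y by rewrite yE mulmxBl mulmxBr !mulmxA.
  apply: Ab; apply: colE.
    by move=> i; rewrite yE mulmxBr (mulmxA a w) aw mul1mx subrr.
  suff -> : A' *m y = (A' - A' *m w *m a) *m z by [].
  by rewrite yE mulmxBl mulmxBr !mulmxA.
have A'w0 i : (A' *m w) i 0 <= 0.
  have := A'z0 i; rewrite /w -scalemxAr !mxE => h.
  by rewrite pmulr_rle0 ?invr_gt0.
(* The multiplier of the row [a] is forced by evaluating the sought identity at [w]. It is
   nonnegative since [b] is positive at [w] while [A' w <= 0] and [u >= 0]. *)
pose t := (b *m w) 0 0 - (u^T *m (A' *m w)) 0 0.
exists (@col_mx _ 1 q 1 t%:M u) => [i|].
  rewrite mxE mxE; case: split_ordP => j _; last by have := u0 j; rewrite mxE.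
  rewrite !ord1 mxE eqxx mulr1n subr_ge0 (@le_trans _ _ 0) //.
    rewrite mxE sumr_le0 // => k _; rewrite mxE mulr_ge0_le0 //.
    by have := u0 k; rewrite mxE.
  by rewrite /w -scalemxAr mxE; apply: mulr_ge0; apply: ltW; rewrite ?invr_gt0.
rewrite (@tr_col_mx _ 1 q 1) (@mul_row_col _ 1 1 q) tr_scalar_mx.
have -> : t%:M = b *m w - u^T *m (A' *m w).
  by apply/matrixP => i j; rewrite !ord1 [LHS]mxE eqxx mulr1n [RHS]mxE [X in _ + X]mxE.
apply/eqP; rewrite mulmxBl -addrA addrC -subr_eq; apply/eqP; rewrite bE.
by rewrite mulmxBr addrC !mulmxA.
Qed.

(* Farkas' lemma is applied to the homogenized dual system
   [W^T u <= t q, 0 <= t]. *)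
Lemma lp_strong_duality p q (W : 'M[R]_(p, q)) (c : 'cV[R]_q) (v u : 'cV[R]_p) :
  is_argmax [set u | lev (W^T *m u) c] (fun u => dot u v) u ->
  exists y, [/\ W *m y = v, lev 0 y & dot c y <= dot u v].
Proof.
move=> [/= uW umax].
pose k := dot u v.
pose A : 'M[R]_(q + 1, p + 1) := block_mx W^T (- c) 0 (- 1%:M).
pose b : 'rV[R]_(p + 1) := row_mx v^T (- k%:M).
have [|w w0 bE] := @farkas _ _ A b.
  move=> z; rewrite -[z]vsubmxK /A /b mul_block_col mul_row_col.
  set e := usubmx z; set s := dsubmx z => h.
  pose t := s 0 0; have sE : s = t%:M by rewrite [LHS]mx11_scalar.
  have We i : (W^T *m e) i 0 <= t * c i 0.
    have := h (lshift 1 i); rewrite col_mxEu sE mulNmx mul_mx_scalar.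
    by rewrite mxE [X in _ + X]mxE [X in _ - X]mxE [X in _ <= X]mxE subr_le0.
  have t0 : 0 <= t.
    have := h (rshift q 0); rewrite col_mxEd mul0mx add0r mulNmx mul1mx mxE.
    by rewrite [X in _ <= X]mxE oppr_le0.
  have -> : (v^T *m e + - k%:M *m s) 0 0 = dot e v - k * t.
    by rewrite sE mulNmx -scalar_mxM dotC [LHS]mxE [in X in _ + X]mxE [in X in _ - X]mxE eqxx mulr1n.
  (* For [t = 0], [e] is a recession direction of the dual set, so [u + e] competes with [u]; for
     [t > 0], [e / t] does. *)
  have [t_eq0|t_neq0] := eqVneq t 0.
    have /umax : lev (W^T *m (u + e)) c.
      move=> i; rewrite mulmxDr mxE; have := We i; rewrite t_eq0 mul0r.
      by have := uW i; lra.
    by rewrite dotDl t_eq0; lra.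
  have tgt0 : 0 < t by rewrite lt_neqAle eq_sym t_neq0.
  have /umax : lev (W^T *m (t^-1 *: e)) c.
    by move=> i; rewrite -scalemxAr mxE ler_pdivrMl.
  by rewrite dotZl ler_pdivrMl // subr_le0 mulrC.
move: bE w0; rewrite -[w]vsubmxK; set y := usubmx w; set s := dsubmx w.
rewrite /b /A tr_col_mx mul_row_block mulmx0 addr0 => /eq_row_mx[vE kE] w0.
exists y; split.
- by apply: trmx_inj; rewrite trmx_mul.
- by move=> i; have := w0 (lshift 1 i); rewrite col_mxEu !mxE.
(* The multiplier [s] of the row [- t <= 0] is the slack in [k = dot c y + s]. *)
have s0 : 0 <= s 0 0 by have := w0 (rshift q 0); rewrite col_mxEd mxE.
move/matrixP : kE => /(_ 0 0).
rewrite [LHS]mxE [X in - X]mxE eqxx mulr1n mulmxN mulmxN mulmx1.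
rewrite [RHS]mxE [X in _ = X + _]mxE [X in _ = _ + X]mxE [X in _ = _ - X]mxE.
by rewrite -/k dotC /dot; lra.
Qed.

End duality.

(** * Estimates for a single proximal step *)

Section proximal_step.
Context {R : realType} {n : nat}.
Variables (X : set 'cV[R]_n) (phi : 'cV[R]_n -> R) (rho : R) (c y : 'cV[R]_n).
Hypothesis X_segment : forall z w lam, 0 <= lam <= 1 -> X z -> X w ->
  X (lam *: z + (1 - lam) *: w).
Hypothesis rho_gt0 : 0 < rho.
Hypothesis y_prox : is_argmin X (fun z => phi z + rho / 2 * enorm (z - c) ^+ 2) y.

Let prox_le z : X z ->
  phi y + rho / 2 * dot (y - c) (y - c) <= phi z + rho / 2 * dot (z - c) (z - c).
Proof. by move=> Xz; rewrite -!sqr_enorm; exact: y_prox.2. Qed.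

(** The minimizer is compared with the point at fraction [lam] from [c] to [z]: convexity gains
    [lam * Gap], and the quadratic term costs the order of [lam ^+ 2]. *)
Lemma prox_gap_ge (F Gap lam : R) z : X c -> X z -> 0 <= lam <= 1 ->
  (forall lam, 0 <= lam <= 1 ->
     phi (lam *: z + (1 - lam) *: c) <= lam * phi z + (1 - lam) * phi c) ->
  phi c <= F -> phi z <= F - Gap ->
  lam * Gap - rho * lam ^+ 2 / 2 * dot (c - z) (c - z) <=
  F - (phi y + rho / 2 * dot (y - c) (y - c)).
Proof.
move=> Xc Xz lam01 phi_cvx phic phiz; have [lam0 lam1] := andP lam01.
have := prox_le (X_segment lam01 Xz Xc).
have -> : lam *: z + (1 - lam) *: c - c = (- lam) *: (c - z).
  by rewrite scalerBr !scaleNr opprK scalerBl scale1r addrAC addrA addrNK addrC.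
have := phi_cvx _ lam01; rewrite dotZl dotZr.
have := ler_wpM2l lam0 phiz.
have : (1 - lam) * phi c <= (1 - lam) * F by rewrite ler_wpM2l // subr_ge0.
nra.
Qed.

(** Moving from [y] back towards [c] by a fraction [lam] raises [phi] by at most [G * lam * s] and
    saves about [rho * lam * s ^+ 2]; minimality of [y] and [lam] tending to 0 give the bound
    without subgradients. *)
Lemma prox_slope_le G : 0 <= G -> X c -> elipschitz G phi -> rho * enorm (c - y) <= G.
Proof.
move=> G0 Xc phi_lip; set s := enorm (c - y).
have s0 : 0 <= s by exact: enorm_ge0.
have ys : dot (y - c) (y - c) = s ^+ 2.
  by rewrite sqr_enorm -(opprB y c) dotNl dotNr opprK.
have key lam : 0 < lam <= 1 -> rho * (1 - lam / 2) * s ^+ 2 <= G * s.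
  move=> /andP[lam0 lam1].
  have lam01 : 0 <= lam <= 1 by rewrite ltW.
  have := prox_le (X_segment lam01 Xc y_prox.1).
  have -> : lam *: c + (1 - lam) *: y - c = (1 - lam) *: (y - c).
    rewrite scalerBr addrAC addrC; congr (_ + _).
    by rewrite scalerBl scale1r opprB addrC.
  have : phi (lam *: c + (1 - lam) *: y) - phi y <= G * (lam * s).
    apply: le_trans (ler_norm _) (le_trans (phi_lip _ _) _).
    have -> : lam *: c + (1 - lam) *: y - y = lam *: (c - y).
      by rewrite scalerBl scale1r scalerBr addrCA addrAC subrr add0r.
    by rewrite enormZ // ltW.
  rewrite !dotZl !dotZr ys => h1 h2.
  by rewrite -(ler_pM2l lam0); nra.
have [s_eq0|s_neq0] := eqVneq s 0.
  by rewrite s_eq0 mulr0.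
have sgt0 : 0 < s by rewrite lt_neqAle eq_sym s_neq0.
apply/ler_addgt0Pr => e e0.
(* Small enough that the error [rho * s * lam / 2] is at most [e]. *)
pose lam := Num.min 1 (2 * e / (rho * s)).
have : rho * (1 - lam / 2) * s <= G.
  rewrite -(ler_pM2r sgt0) -[leLHS]mulrA key // lt_min ltr01 ge_min lexx /= andbT.
  by rewrite divr_gt0 ?mulr_gt0.
have : lam * (rho * s) <= 2 * e.
  by rewrite -ler_pdivlMr ?mulr_gt0 // ge_min lexx orbT.
by lra.
Qed.

End proximal_step.

(* The minimum over [w] of the maximum of the two minorants of [psi] at [w] is
   bounded below through their convex combination with weight [tau]. *)
Lemma null_step_gain {R : realType} n (psi : 'cV[R]_n -> R) (rho G phiy Fy e tau : R)
    (c y w g : 'cV[R]_n) :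
  0 < rho -> 0 <= tau <= 1 ->
  enorm g <= G -> rho * enorm (c - y) <= G ->
  Fy + dot g (w - y) <= psi w ->
  phiy + dot (rho *: (c - y)) (w - y) <= psi w ->
  e <= Fy - phiy ->
  phiy + rho / 2 * dot (y - c) (y - c) + tau * e - 2 * G ^+ 2 * tau ^+ 2 / rho <=
  psi w + rho / 2 * dot (w - c) (w - c).
Proof.
move=> rho0 /andP[tau0 tau1] gG sG cut agg eF.
have G0 : 0 <= G by exact: le_trans (enorm_ge0 _) gG.
have gg := enorm_dot_le G0 gG.
pose s := rho *: (c - y).
have ss : dot s s <= G ^+ 2 by apply: enorm_dot_le => //; rewrite enormZ // ltW.
pose d := w - y.
have sE : y - c = - rho^-1 *: s.
  by rewrite /s scaleNr scalerA mulVf ?gt_eqF // scale1r opprB.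
have -> : w - c = d + (y - c) by rewrite /d addrA addrNK.
(* Parallelogram identity: the square of [g - s] is at most [2 |g|^2 + 2 |s|^2]. *)
have Dg : dot (g - s) (g - s) <= 4 * G ^+ 2.
  by have := dot_ge0 (g + s); rewrite !(dotDl, dotDr, dotNl, dotNr) (dotC s g); lra.
(* Completing the square in [d] bounds the worst effect of the slope difference, weighted by [tau],
   against the quadratic term. *)
have sq := dot_ge0 (rho *: d + tau *: (g - s)).
have {}sq : 0 <= rho / 2 * dot d d + tau * dot (g - s) d + tau ^+ 2 * (2 * G ^+ 2) / rho.
  rewrite -(pmulr_rge0 _ rho0).
  have -> : rho * (rho / 2 * dot d d + tau * dot (g - s) d + tau ^+ 2 * (2 * G ^+ 2) / rho) =
    (rho ^+ 2 * dot d d + 2 * rho * tau * dot (g - s) d + tau ^+ 2 * (4 * G ^+ 2)) / 2.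
    by field; rewrite gt_eqF.
  apply: divr_ge0 => //; apply: le_trans sq _.
  have := ler_wpM2l (sqr_ge0 tau) Dg.
  rewrite dot_lincomb.
  by lra.
(* The aggregate slope cancels the cross term in the expansion of the square of [d + (y - c)]. *)
have ds : rho * dot (y - c) d = - dot s d.
  by rewrite sE dotZl mulrA mulrN divff ?gt_eqF // mulN1r.
have -> : dot (d + (y - c)) (d + (y - c)) =
    dot d d + 2 * dot (y - c) d + dot (y - c) (y - c).
  by have := dot_lincomb 1 1 d (y - c); rewrite !scale1r => ->; ring.
have gsd : dot (g - s) d = dot g d - dot s d by rewrite dotDl dotNl.
move: sq; rewrite gsd.
have := ler_wpM2l tau0 eF.
have := ler_wpM2l tau0 cut.
have : (1 - tau) * (phiy + dot s d) <= (1 - tau) * psi w.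
  by rewrite ler_wpM2l // subr_ge0.
rewrite -/d; move: ds.
by nra.
Qed.

(** With [p = a * v t], the bound [(t + 1) p <= 1] gives [(t + 2) (p - p^2) <= (1 + p) (1 - p) <=
    1]. The bound [M] is carried along because the decrease is supplied only below it. *)
Lemma quadratic_decrease {R : realFieldType} (v : nat -> R) (N : nat) (a M : R) :
  0 < a -> a * M <= 1 -> v 0%N <= M ->
  (forall t, (t < N)%N -> 0 < v t) ->
  (forall t, (t.+1 < N)%N -> v t <= M -> v t.+1 <= v t - a * v t ^+ 2) ->
  forall t, (t < N)%N -> v t <= M /\ a * t.+1%:R * v t <= 1.
Proof.
move=> a0 aM v0 vpos vS; elim=> [|t IH] tN.
  split=> //; rewrite mulr1; apply: le_trans aM; by rewrite ler_pM2l.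
have [vM av] := IH (ltnW tN).
have vt := vpos _ (ltnW tN).
have h := vS _ tN vM.
split; first by apply: le_trans h (le_trans _ vM); rewrite gerBl mulr_ge0 ?sqr_ge0 // ltW.
have := ler_wpM2l (ltW a0) h; set p := a * v t in av *.
have p0 : 0 < p by rewrite mulr_gt0.
have tp : t.+1%:R * p <= 1 by apply: le_trans av; rewrite /p mulrAC mulrC.
have -> : a * (v t - a * v t ^+ 2) = p - p ^+ 2 by rewrite /p; ring.
move=> {}h.
have -> : a * t.+2%:R * v t.+1 = t.+2%:R * (a * v t.+1) by ring.
apply: le_trans (ler_wpM2l (ler0n _ _) h) _.
have p1 : p <= 1 by apply: le_trans tp; rewrite ler_peMl ?ler1n // ltW.
have -> : t.+2%:R = t.+1%:R + 1 :> R by rewrite -natr1.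
by nra.
Qed.

(** * Recourse values, sample averages and their gradient cuts *)

Section recourse_theory.
Context {R : realType} {m n r l : nat} {d : measure_display}
  {Xi : measurableType d}.
Variable pb : tslp R m n r l Xi.
Implicit Types (z : 'cV[R]_n) (xi : Xi) (u : 'cV[R]_r) (S : seq Xi).

Lemma feasible_segment z w (lam : R) : 0 <= lam <= 1 ->
  feasible pb z -> feasible pb w -> feasible pb (lam *: z + (1 - lam) *: w).
Proof.
move=> /andP[lam0 lam1] [Az z0] [Aw w0]; split.
  by rewrite mulmxDr -!scalemxAr Az Aw -scalerDl addrC subrK scale1r.
move=> i; have := z0 i; have := w0 i; rewrite !mxE => ? ?.
by rewrite addr_ge0 // mulr_ge0 // subr_ge0.
Qed.

Lemma recourse_ge z xi u : dual_set pb xi u ->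
  ((dot u (lph pb xi - lpT pb xi *m z))%:E <= recourse pb z xi)%E.
Proof.
move=> uq; apply: le_ereal_inf_tmp => _ [y [/= Ty y0] <-]; rewrite lee_fin.
rewrite -Ty addrC addKr.
have -> : dot u (lpW pb *m y) = dot ((lpW pb)^T *m u) y.
  by rewrite /dot trmx_mul trmxK mulmxA.
exact: ler_dotl.
Qed.

(** Weak duality is one inequality; strong duality provides a feasible second-stage point for the
    other. *)
Lemma recourse_dual_argmax z xi u : dual_argmax pb z xi u ->
  recourse pb z xi = (dot u (lph pb xi - lpT pb xi *m z))%:E.
Proof.
move=> umax; apply/eqP; rewrite eq_le recourse_ge ?andbT; last exact: umax.1.
have [y [Wy y0 qy]] := lp_strong_duality umax.
apply: ge_ereal_inf; exists (dot (lpq pb xi) y)%:E; last by rewrite lee_fin.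
by exists y => //; split=> //; rewrite Wy addrC subrK.
Qed.

Variables (U : 'cV[R]_n -> Xi -> 'cV[R]_r) (S : seq Xi).
Hypothesis U_argmax : forall xi, xi \in S -> forall z, feasible pb z ->
  dual_argmax pb z xi (U z xi).

Lemma saaE z : feasible pb z -> saa pb S z =
  (dot (lpc pb) z + (size S)%:R^-1 *
     \sum_(xi <- S) dot (U z xi) (lph pb xi - lpT pb xi *m z))%:E.
Proof.
move=> Xz; rewrite /saa EFinD EFinM -sumEFin big_seq [in RHS]big_seq.
by congr (_ + _ * _)%E; apply: eq_bigr => xi xiS; rewrite (recourse_dual_argmax (U_argmax xiS Xz)).
Qed.

(** Feasible points have finite recourse values on the samples, so [fine] loses nothing there. *)
Lemma saa_valE z : feasible pb z -> saa pb S z = (saa_val pb S z)%:E.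
Proof. by move=> Xz; rewrite /saa_val saaE. Qed.

(** The dual set does not depend on the first-stage point, so [U z xi] is still dual feasible at [w]
    and bounds the recourse there from below. *)
Lemma grad_cut_le z w : feasible pb z -> feasible pb w ->
  grad_cut pb U S z w <= saa_val pb S w.
Proof.
move=> Xz Xw; rewrite /grad_cut /saa_grad /saa_val !saaE //=.
set N := (size S)%:R^-1.
have N0 : 0 <= N by rewrite invr_ge0.
rewrite dotDl dotNl dotZl.
have -> : dot (\sum_(xi <- S) (lpT pb xi)^T *m U z xi) (w - z) =
    \sum_(xi <- S) dot (U z xi) (lpT pb xi *m (w - z)).
  rewrite dotC /dot mulmx_sumr summxE; apply: eq_bigr => xi _.
  by rewrite mulmxA -trmx_mul -/(dot _ _) dotC.
have h : \sum_(xi <- S) dot (U z xi) (lph pb xi - lpT pb xi *m z) -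
    \sum_(xi <- S) dot (U z xi) (lpT pb xi *m (w - z)) <=
    \sum_(xi <- S) dot (U w xi) (lph pb xi - lpT pb xi *m w).
  rewrite -sumrB big_seq [leRHS]big_seq; apply: ler_sum => xi xiS.
  have := recourse_ge w (U_argmax xiS Xz).1.
  rewrite (recourse_dual_argmax (U_argmax xiS Xw)) lee_fin.
  by rewrite -dotNr -dotDr mulmxBr opprB addrA subrK.
have := ler_wpM2l N0 h; rewrite dotDr dotNr mulrBr; lra.
Qed.

End recourse_theory.

(** Strict slack yields a nearly closest point, which stands in for a projection onto [Y]. *)
Lemma dist_lt {R : realType} n (z : 'cV[R]_n) (Y : set 'cV[R]_n) (a : R) :
  Y !=set0 -> dist z Y < a -> exists2 y, Y y & enorm (z - y) < a.
Proof.
move=> [y0 Yy0] lt_a.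
have [|_ [y Yy <-] ya] := inf_lt _ lt_a; first by exists (enorm (z - y0)), y0.
by exists y.
Qed.

Lemma convex_function_segment {R : realType} n (phi : 'cV[R]_n -> R) :
  convex_function setT (phi : convex_lmodType 'cV[R]_n -> R^o) ->
  forall z w lam, 0 <= lam <= 1 ->
  phi (lam *: z + (1 - lam) *: w) <= lam * phi z + (1 - lam) * phi w.
Proof.
move=> cvx z w lam /andP[lam0 lam1].
exact: cvx (Itv01 lam0 lam1) z w (mem_setT _) (mem_setT _).
Qed.

(** * The iteration count and its logarithmic growth *)

Section rates_asymptotics.
Context {R : realType}.
Variables (beta gap0 : R).
Hypothesis beta_itv : 0 < beta < 1.

Let lnb : R := - ln (1 - beta / 2).

Let lnb_gt0 : 0 < lnb.
Proof.
have [b0 b1] := andP beta_itv.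
by rewrite oppr_gt0 ln_lt0 //; apply/andP; split; lra.
Qed.

Lemma K_SI_ge0 e : 0 <= K_SI beta gap0 e.
Proof. by rewrite /K_SI; case: ifP => // _; rewrite le_max lexx. Qed.

(** With [y] the argument of the logarithm, [K_SI] is large enough that the contraction factor
    raised to it is at most [1 / y]; the logarithm of the factor is negative, which turns the
    inequality around. *)
Lemma K_SI_contraction e : 0 < e -> 3 * e / beta < gap0 ->
  (1 - beta / 2) ^+ `|K_SI beta gap0 e|%N * (gap0 - 3 * e / beta) <= e / beta.
Proof.
move=> e0 gap; have [b0 b1] := andP beta_itv.
have q0 : 0 < 1 - beta / 2 by lra.
have eb : 0 < e / beta by rewrite divr_gt0.
pose y := (gap0 - 3 * e / beta) / (e / beta).
have y0 : 0 < y by rewrite divr_gt0 // subr_gt0.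
have K_ge : - logb (1 - beta / 2) y <= (K_SI beta gap0 e)%:~R.
  rewrite /K_SI ifF -/y; last by apply/negbTE; rewrite -ltNge.
  by apply: le_trans (ceil_ge _) _; rewrite ler_int le_max lexx orbT.
set K := `|_|%N.
have KE : (K_SI beta gap0 e)%:~R = K%:R :> R.
  by rewrite [RHS]pmulrn; congr (_%:~R); rewrite gez0_abs // K_SI_ge0.
have : ln ((1 - beta / 2) ^+ K) <= ln y^-1.
  rewrite lnXn // lnV ?posrE // -[leLHS]mulr_natr -KE.
  have lnq : ln (1 - beta / 2) < 0 by rewrite -oppr_gt0.
  have := ler_wnM2l (ltW lnq) K_ge; rewrite /logb mulrN mulrCA divff ?lt_eqF //.
  by rewrite mulr1.
rewrite ler_ln ?posrE ?exprn_gt0 ?invr_gt0 // => h.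
by rewrite -ler_pdivlMr ?subr_gt0 // -[leRHS]invf_div.
Qed.

Lemma K_SI_le e : 0 < e ->
  (K_SI beta gap0 e)%:~R <= (`|ln (gap0 * beta)| + `|ln e^-1|) / lnb + 1 :> R.
Proof.
move=> e0; have [b0 b1] := andP beta_itv.
have pos : 0 <= (`|ln (gap0 * beta)| + `|ln e^-1|) / lnb + 1.
  by rewrite addr_ge0 // divr_ge0 ?addr_ge0 // ltW.
rewrite /K_SI; case: ifPn => [//|]; rewrite -ltNge => gap.
have eb : 0 < e / beta by rewrite divr_gt0.
have gap_gt0 : 0 < gap0 by apply: lt_trans gap; rewrite !mulr_gt0 ?invr_gt0.
set y := (gap0 - 3 * e / beta) / (e / beta).
have y0 : 0 < y by rewrite divr_gt0 // subr_gt0.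
(* Dropping [3 * e / beta] from the numerator of [y] leaves [gap0 * beta / e]. *)
have y_le : ln y <= ln (gap0 * beta) + ln e^-1.
  rewrite -lnM ?posrE ?invr_gt0 ?mulr_gt0 // ler_ln ?posrE ?divr_gt0 ?mulr_gt0 ?subr_gt0 //.
  have -> : gap0 * beta / e = gap0 / (e / beta) by rewrite invf_div mulrA.
  by rewrite ler_wpM2r ?invr_ge0 ?(ltW eb) // gerBl !mulr_ge0 ?invr_ge0 // ltW.
rewrite maxEle; case: ifP => _ //.
have /andP[+ _] := ceil_itv (- logb (1 - beta / 2) y).
rewrite intrD ltrBlDr => /ltW /le_trans; apply; rewrite lerD2r.
rewrite /logb -mulrN -invrN -/lnb ler_wpM2r ?invr_ge0 ?(ltW lnb_gt0) //.
by apply: le_trans y_le _; rewrite lerD // ler_norm.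
Qed.

Lemma K_SI_bigO : (fun e : R => (K_SI beta gap0 e)%:~R : R^o) =O_ (0^'+)
  (fun e : R => ln e^-1 : R^o).
Proof.
apply/eqO_exP.
exists ((`|ln (gap0 * beta)| + 1) / lnb + 1).
  by rewrite ltr_wpDl // divr_ge0 ?addr_ge0 // ltW.
near=> e.
have e0 : 0 < e by near: e; exact: nbhs_right_gt.
(* Once this logarithm is at least 1, additive constants are absorbed into the factor. *)
have lne : 1 <= `|ln e^-1|.
  have e1 : e < expR (-1) by near: e; apply: nbhs_right_lt; rewrite expR_gt0.
  apply: le_trans (ler_norm _); rewrite lnV ?posrE // lerNr -[leRHS]expRK.
  by rewrite ler_ln ?posrE ?expR_gt0 // ltW.
rewrite ger0_norm ?ler0z ?K_SI_ge0 //; apply: le_trans (K_SI_le e0) _.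
rewrite [leRHS]mulrDl mul1r lerD // [leRHS]mulrAC ler_wpM2r ?invr_ge0 ?(ltW lnb_gt0) //.
by rewrite mulrDl mul1r lerD2r ler_peMr.
Unshelve. all: by end_near. Qed.

Lemma steps_SI_bigO G mu : (fun e : R => steps_SI G mu beta gap0 e : R^o) =O_ (0^'+)
  (fun e : R => ln e^-1 : R^o).
Proof.
set C := 16 * G ^+ 2 /
    ((1 - beta) ^+ 2 * mu ^+ 2 * (1 - 2 * beta / (3 * (beta + 1)))).
have -> : (fun e : R => steps_SI G mu beta gap0 e : R^o) =
  C *: (fun e : R => (K_SI beta gap0 e)%:~R : R^o) by [].
have /eqO_exP[k k0 kK] := K_SI_bigO.
(* The summand 1 keeps the constant positive when [C] vanishes. *)
apply/eqO_exP; exists (`|C| * k + 1); first by rewrite ltr_wpDl // mulr_ge0 // ltW.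
near=> e.
have : `|((K_SI beta gap0 e)%:~R : R^o)| <= k * `|ln e^-1 : R^o| by near: e.
move=> /(ler_wpM2l (normr_ge0 C)) h.
by rewrite /= normrM mulrDl mul1r -mulrA (le_trans h) // lerDl.
Unshelve. all: by end_near. Qed.

End rates_asymptotics.

(** * A run of the algorithm: iterates and bundle models *)

Section convergence.
Context {R : realType} {m n r l : nat} {d : measure_display}
  {Xi : measurableType d}.
Variables (P : probability Xi R) (pb : tslp R m n r l Xi) (fstar : R).
Variables (beta : R) (U : 'cV[R]_n -> Xi -> 'cV[R]_r) (smp : nat -> seq Xi).
Variables (rho : nat -> R) (x : nat -> nat -> 'cV[R]_n).
Variables (fb : nat -> nat -> 'cV[R]_n -> R) (T : nat -> option nat).
Variables (Jg Js : nat -> nat -> pred nat) (eps1 eps2 G mu ebar : R).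
Hypothesis optimal_neq0 : optimal_set pb P fstar !=set0.
Hypothesis beta_itv : 0 < beta < 1.
Hypothesis U_argmax : forall k, reached T k -> forall xi, xi \in smp k ->
  forall z, feasible pb z -> dual_argmax pb z xi (U z xi).
Hypothesis run : lshaped_run pb U beta smp rho x fb T Jg Js.
Hypothesis saa_approx : forall k, reached T k -> forall z, feasible pb z ->
  ((objective pb P z - eps1)%:E <= saa pb (smp k) z <=
   (objective pb P z + eps2)%:E)%E.
Hypothesis G_gt0 : 0 < G.
Hypothesis grad_bound : forall k, reached T k -> forall z, feasible pb z ->
  enorm (saa_grad pb U (smp k) z) <= G.
Hypothesis bundle : bundle_assumption pb U smp rho x fb T G.
Hypothesis mu_gt0 : 0 < mu.
Hypothesis f_sharp : sharp pb P fstar mu.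
Hypothesis ebarE : ebar = (beta + 1) * (eps1 + eps2).
Hypothesis ebar_gt0 : 0 < ebar.
Hypothesis rhoE : forall k, reached T k ->
  rho k = mu ^+ 2 / (saa_val pb (smp k) (x k 0%N) - eps2 - fstar) /\ 0 < rho k.

Let f := objective pb P.
Let fh k := saa_val pb (smp k).
(** [gap], [egap] and [prox_gap] are the quantities D, E and v_t of the proof idea. *)
Let gap k := f (x k 0%N) - fstar.
Let egap k := fh k (x k 0%N) - eps2 - fstar.
Let step2 k t := dot (x k t.+1 - x k 0%N) (x k t.+1 - x k 0%N).
Let prox_gap k t := fh k (x k 0%N) - (fb k t (x k t.+1) + rho k / 2 * step2 k t).

Let eps_gt0 : 0 < eps1 + eps2.
Proof.
by have [b0 _] := andP beta_itv; move: ebar_gt0; rewrite ebarE pmulr_rgt0 // addr_gt0.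
Qed.

Lemma reachedS k : reached T k.+1 -> exists t,
  [/\ T k = Some t.+1, serious pb beta smp x fb k t & x k.+1 0%N = x k t.+1].
Proof.
move=> kS; have rk : reached T k by move=> j jk; apply: kS; exact: ltnW.
have := kS k (ltnSn k); have := run_T_gt0 run rk; rewrite /lt_steps.
(* [run_T_gt0] excludes [Some 0], so the serious step has index one less than the number of inner
   steps. *)
case Tk: (T k) => [[//|t]|] // _ _; exists t.
by have [] := run_serious run rk Tk.
Qed.

Lemma reachedW k : reached T k.+1 -> reached T k.
Proof. by move=> kS j jk; apply: kS; exact: ltnW. Qed.

Lemma inner_feasible k t : reached T k -> lt_steps T t k -> feasible pb (x k t.+1).
Proof. by move=> rk tk; have [] := run_prox run rk tk. Qed.

Lemma outer_feasible k : reached T k -> feasible pb (x k 0%N).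
Proof.
case: k => [_|k rk]; first exact: run_init run.
have [t [Tk _ ->]] := reachedS rk.
by apply: inner_feasible; [exact: reachedW|rewrite /lt_steps Tk].
Qed.

Lemma fh_approx k z : reached T k -> feasible pb z ->
  f z - eps1 <= fh k z /\ fh k z <= f z + eps2.
Proof.
move=> rk Xz; apply/andP.
by have := saa_approx rk Xz; rewrite (saa_valE (U_argmax rk) Xz) !lee_fin.
Qed.

(** The bundle hypothesis covers the models from index 1 on; the model of index 0 is a single
    gradient cut and is treated separately, here and in the next two lemmas. *)
Lemma model_le k t z : reached T k -> lt_steps T t k -> feasible pb z ->
  fb k t z <= fh k z.
Proof.
move=> rk; case: t => [_|t tk] Xz.
  by rewrite (run_fb0 run rk) (grad_cut_le (U_argmax rk)) //; exact: outer_feasible.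
have [_ _ /(_ z)[+ _]] := bundle rk tk.
by rewrite (saa_valE (U_argmax rk) Xz) lee_fin.
Qed.

Lemma model_segment k t z w lam : reached T k -> lt_steps T t k -> 0 <= lam <= 1 ->
  fb k t (lam *: z + (1 - lam) *: w) <= lam * fb k t z + (1 - lam) * fb k t w.
Proof.
move=> rk; case: t => [_|t tk] lam01.
  rewrite !(run_fb0 run rk) /grad_cut !dotDr !dotZr !dotNr.
  by rewrite le_eqVlt; apply/orP; left; apply/eqP; ring.
by have [cvx _ _] := bundle rk tk; exact: convex_function_segment.
Qed.

Lemma model_lipschitz k t : reached T k -> lt_steps T t k -> elipschitz G (fb k t).
Proof.
move=> rk; case: t => [_|t tk]; last by have [] := bundle rk tk.
move=> z w; rewrite !(run_fb0 run rk) /grad_cut opprD addrACA subrr add0r.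
rewrite -dotNr -dotDr opprB addrA subrK.
by rewrite norm_dot_enorm_le // grad_bound //; exact: outer_feasible.
Qed.

(** * The proximal gap and the contraction of the true gap *)

Lemma egap_gt0 k : reached T k -> 0 < egap k.
Proof.
move=> rk; have [rkE] := rhoE rk.
by rewrite rkE pmulr_rgt0 ?exprn_gt0 // invr_gt0.
Qed.

Lemma gap_bounds k : reached T k -> egap k <= gap k /\ gap k <= egap k + (eps1 + eps2).
Proof.
move=> rk; have [] := fh_approx rk (outer_feasible rk).
by rewrite /egap /gap; lra.
Qed.

Lemma prox_gap_ge_egap k t : reached T k -> lt_steps T t k ->
  egap k ^+ 3 / (2 * gap k ^+ 2) <= prox_gap k t.
Proof.
move=> rk tk; have e0 := egap_gt0 rk; have [eg _] := gap_bounds rk.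
have g0 : 0 < gap k by exact: lt_le_trans eg.
have [rkE rk0] := rhoE rk.
set E := egap k in e0 eg *; set D := gap k in eg g0 *.
have Xx := outer_feasible rk.
apply/ler_addgt0Pr => e e_gt0.
(* This fraction maximizes [lam * E - lam ^+ 2 * D ^+ 2 / (2 * E)], with maximum
   [E ^+ 3 / (2 * D ^+ 2)]. *)
pose lam := (E / D) ^+ 2.
have lam0 : 0 < lam by rewrite exprn_gt0 // divr_gt0.
have lam01 : 0 <= lam <= 1.
  by rewrite ltW //= expr_le1 // ?divr_ge0 ?(ltW g0) ?(ltW e0) // ler_pdivrMr // mul1r.
(* Sharpness bounds the distance to the optimal set by [D / mu]; the surplus over its square costs
   exactly [e] in the proximal estimate. *)
pose c2 := (D / mu) ^+ 2 + 2 * e / (rho k * lam ^+ 2).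
have c2_gt : (D / mu) ^+ 2 < c2.
  rewrite ltrDl; apply: divr_gt0; first by rewrite mulr_gt0.
  by rewrite mulr_gt0 // exprn_gt0.
have Dmu : 0 <= D / mu by rewrite divr_ge0 // ltW.
have : dist (x k 0%N) (optimal_set pb P fstar) < Num.sqrt c2.
  apply: (@le_lt_trans _ _ (D / mu)); first by rewrite ler_pdivlMr // mulrC f_sharp.
  by rewrite -(ger0_norm Dmu) -sqrtr_sqr ltr_sqrt // (le_lt_trans _ c2_gt) // sqr_ge0.
move=> /(dist_lt optimal_neq0)[z [Xz fz] /ltW zc].
have {}zc : dot (x k 0%N - z) (x k 0%N - z) <= c2.
  rewrite -[leRHS]sqr_sqrtr ?(le_trans _ (ltW c2_gt)) ?sqr_ge0 //.
  exact: enorm_dot_le (sqrtr_ge0 _) zc.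
have [_ fhz] := fh_approx rk Xz.
have := @prox_gap_ge R n (feasible pb) (fb k t) (rho k) (x k 0%N) (x k t.+1)
  (fun z w lam => @feasible_segment _ _ _ _ _ _ _ pb z w lam)
  (run_prox run rk tk) (fh k (x k 0%N)) E lam z Xx Xz lam01
  (fun s => @model_segment k t z (x k 0%N) s rk tk)
  (model_le rk tk Xx).
have -> : fh k (x k 0%N) - E = fstar + eps2 by rewrite /E /egap; ring.
rewrite -fz => /(_ (le_trans (model_le rk tk Xz) fhz)) h.
rewrite -lerBlDr; apply: le_trans h.
have zc' : rho k * lam ^+ 2 / 2 * dot (x k 0%N - z) (x k 0%N - z) <= rho k * lam ^+ 2 / 2 * c2.
  by rewrite ler_wpM2l // divr_ge0 // mulr_ge0 ?sqr_ge0 // ltW.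
apply: le_trans (lerB (lexx _) zc').
rewrite le_eqVlt; apply/orP; left; apply/eqP.
rewrite /c2 /lam rkE -/(fh k _) -/(egap k) -/E.
by field; rewrite !gt_eqF.
Qed.

(** Sampling errors cost [eps1 + eps2], and replacing [egap] by [gap] in the decrease costs
    [3 * beta * (eps1 + eps2) / 2]; together this is at most [3 * ebar / 2]. *)
Lemma gap_contraction k : reached T k.+1 ->
  gap k.+1 <= (1 - beta / 2) * gap k + 3 * ebar / 2.
Proof.
move=> rkS; have rk := reachedW rkS; have [b0 b1] := andP beta_itv.
have [t [Tk ser xE]] := reachedS rkS.
have tk : lt_steps T t k by rewrite /lt_steps Tk.
have e0 := egap_gt0 rk; have [eg ge] := gap_bounds rk.
have g0 : 0 < gap k by exact: lt_le_trans eg.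
have vge := prox_gap_ge_egap rk tk.
have [fx1 _] := fh_approx rk (inner_feasible rk tk).
have step2_ge0 : 0 <= rho k / 2 * step2 k t.
  by rewrite mulr_ge0 ?dot_ge0 // divr_ge0 // ltW //; have [] := rhoE rk.
move: ser; rewrite /serious -/(fh k _) -/(fh k _) => ser.
(* The cube lies above its tangent at [gap k]: E^3 >= D^2 (3 E - 2 D). *)
have cube : (3 * egap k - 2 * gap k) / 2 <= egap k ^+ 3 / (2 * gap k ^+ 2).
  rewrite ler_pdivlMr ?mulr_gt0 ?exprn_gt0 //.
  have := mulr_ge0 (sqr_ge0 (egap k - gap k)) (addr_ge0 (ltW e0) (mulr_ge0 (ler0n R 2) (ltW g0))).
  by lra.
have : beta * ((3 * egap k - 2 * gap k) / 2) <= fh k (x k 0%N) - fh k (x k t.+1).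
  apply: le_trans ser; rewrite ler_wpM2l ?(ltW b0) //; move: vge; rewrite /prox_gap; lra.
have bge := ler_wpM2l (ltW b0) ge; have beg := ler_wpM2l (ltW b0) eg.
have be := mulr_gt0 b0 eps_gt0.
have -> : gap k.+1 = f (x k t.+1) - fstar by rewrite /gap xE.
rewrite ebarE.
have : fh k (x k 0%N) = egap k + eps2 + fstar by rewrite /egap; ring.
lra.
Qed.

(** * Decrease of the proximal gap and length of the inner loop *)

Lemma prox_gap0_le k : reached T k -> prox_gap k 0%N <= G ^+ 2 / (2 * rho k).
Proof.
move=> rk; have [_ rk0] := rhoE rk; rewrite /prox_gap /step2 (run_fb0 run rk) /grad_cut.
set g := saa_grad _ _ _ _; set e := x k 1%N - _.
have gg : dot g g <= G ^+ 2.
  exact: enorm_dot_le (ltW G_gt0) (grad_bound rk (outer_feasible rk)).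
rewrite ler_pdivlMr ?mulr_gt0 // -/(fh k _).
(* Completing the square: [g + rho k *: e] has nonnegative square. *)
have := dot_lincomb 1 (rho k) g e; have := dot_ge0 (1 *: g + rho k *: e).
by rewrite (dotC e g) => + E; rewrite E; nra.
Qed.

Lemma prox_gap_decrease k t : reached T k -> lt_steps T t.+1 k ->
  0 < prox_gap k t -> prox_gap k t <= G ^+ 2 / (2 * rho k) ->
  prox_gap k t.+1 <= prox_gap k t -
    (1 - beta) ^+ 2 * rho k / (8 * G ^+ 2) * prox_gap k t ^+ 2.
Proof.
move=> rk tSk v0 vM; have [b0 b1] := andP beta_itv; have [_ rk0] := rhoE rk.
have tk : lt_steps T t k by move: tSk; rewrite /lt_steps; case: (T k) => // N /ltnW.
have Xx := outer_feasible rk.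
have [nser _] := run_null run rk tSk.
have [_ _ /(_ (x k t.+2))[_]] := bundle rk tSk.
rewrite ge_max => /andP[cut agg].
set v := prox_gap k t in v0 vM *.
have G2 : 0 < G ^+ 2 by rewrite exprn_gt0.
have step2_ge0 : 0 <= rho k / 2 * step2 k t.
  by rewrite mulr_ge0 ?dot_ge0 // divr_ge0 // ltW.
(* Failure of the descent test leaves the model at least this far below the sample objective at the
   new point. *)
have e_le : (1 - beta) * v <= fh k (x k t.+1) - fb k t (x k t.+1).
  move: nser => /negP; rewrite -ltNge -/(fh k _) -/(fh k _) => nser.
  have : v <= fh k (x k 0%N) - fb k t (x k t.+1) by rewrite /v /prox_gap; lra.
  rewrite -(ler_pM2l (_ : 0 < 1 - beta)) ?subr_gt0 // => h.
  by apply: le_trans h _; lra.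
(* The maximizer of [tau * (1 - beta) * v - 2 * G ^+ 2 * tau ^+ 2 / rho k]; the bound on [v] keeps
   it below 1. *)
pose tau := (1 - beta) * v * rho k / (4 * G ^+ 2).
have tau01 : 0 <= tau <= 1.
  have b1' : 0 <= 1 - beta by rewrite subr_ge0 ltW.
  apply/andP; split.
    apply: divr_ge0; last by rewrite mulr_ge0 // ltW.
    by rewrite mulr_ge0 ?(ltW rk0) // mulr_ge0 // ltW.
  rewrite ler_pdivrMr ?mulr_gt0 // mul1r.
  move: vM; rewrite ler_pdivlMr ?mulr_gt0 // => vM.
  have := mulr_gt0 v0 rk0; nra.
have := null_step_gain rk0 tau01 (grad_bound rk (inner_feasible rk tk))
  (@prox_slope_le R n (feasible pb) (fb k t) (rho k) (x k 0%N) (x k t.+1)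
    (fun z w lam => @feasible_segment _ _ _ _ _ _ _ pb z w lam) rk0
    (run_prox run rk tk) G (ltW G_gt0) Xx (model_lipschitz rk tk)) cut agg e_le.
have -> : tau * ((1 - beta) * v) = 
  2 * ((1 - beta) ^+ 2 * rho k / (8 * G ^+ 2) * v ^+ 2).
  by rewrite /tau; field; rewrite gt_eqF.
have -> : 2 * G ^+ 2 * tau ^+ 2 / rho k =
  (1 - beta) ^+ 2 * rho k / (8 * G ^+ 2) * v ^+ 2.
  by rewrite /tau; field; rewrite !gt_eqF.
rewrite -/(step2 k t) -/(step2 k t.+1).
have vE : v = prox_gap k t by [].
rewrite {3}vE /prox_gap; lra.
Qed.

Let step_bound :=
  16 * G ^+ 2 / ((1 - beta) ^+ 2 * mu ^+ 2 * (1 - 2 * beta / (3 * (beta + 1)))).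

Let kappa_gt0 : 0 < 1 - 2 * beta / (3 * (beta + 1)).
Proof.
have [b0 b1] := andP beta_itv.
by rewrite subr_gt0 ltr_pdivrMr ?mul1r ?mulr_gt0 ?addr_gt0 //; lra.
Qed.

(** [N] is any number of steps performed, so that the bound also rules out an infinite inner
    loop. *)
Lemma inner_steps_le k N : reached T k -> delta_SI beta ebar < gap k ->
  (forall t, (t < N)%N -> lt_steps T t k) -> N%:R <= step_bound.
Proof.
move=> rk gap_gt Nk; have [b0 b1] := andP beta_itv.
have den0 : 0 < (1 - beta) ^+ 2 * mu ^+ 2 * (1 - 2 * beta / (3 * (beta + 1))).
  by rewrite mulr_gt0 // mulr_gt0 // exprn_gt0 // subr_gt0.
case: N Nk => [|N] Nk.
  by rewrite divr_ge0 ?(ltW den0) // mulr_ge0 // sqr_ge0.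
have [rkE rk0] := rhoE rk.
have e0 := egap_gt0 rk; have [eg ge] := gap_bounds rk.
have g0 : 0 < gap k by exact: lt_le_trans eg.
have G2 : 0 < G ^+ 2 by rewrite exprn_gt0.
have b2 : 0 < (1 - beta) ^+ 2 by rewrite exprn_gt0 // subr_gt0.
pose a := (1 - beta) ^+ 2 * rho k / (8 * G ^+ 2).
have a0 : 0 < a by rewrite divr_gt0 // mulr_gt0 //.
have v_gt0 t : (t < N.+1)%N -> 0 < prox_gap k t.
  move=> /Nk tk; apply: lt_le_trans (prox_gap_ge_egap rk tk).
  by rewrite divr_gt0 ?exprn_gt0 // mulr_gt0 // exprn_gt0.
have aM : a * (G ^+ 2 / (2 * rho k)) <= 1.
  have -> : a * (G ^+ 2 / (2 * rho k)) = (1 - beta) ^+ 2 / 16.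
    by rewrite /a; field; rewrite !gt_eqF.
  by nra.
have [|_ aN] := quadratic_decrease a0 aM (prox_gap0_le rk) v_gt0 _ (ltnSn N).
  by move=> t tN vM; apply: prox_gap_decrease => //; [exact: Nk|exact: v_gt0 (ltnW tN)].
have V_le := prox_gap_ge_egap rk (Nk _ (ltnSn N)).
pose th := egap k / gap k.
(* A gap above [delta_SI] makes [eps1 + eps2] at most the fraction [beta / (4 * (beta + 1))] of it;
   the square of the resulting bound on [th] exceeds the stated constant. *)
have th2 : 1 - 2 * beta / (3 * (beta + 1)) <= th ^+ 2.
  have ebarE' : ebar / (beta + 1) = eps1 + eps2.
    by rewrite ebarE mulrAC divff ?mul1r // gt_eqF // addr_gt0.
  have th_ge : 1 - beta / (4 * (beta + 1)) <= th.
    rewrite /th ler_pdivlMr // mulrBl mul1r lerBlDr; apply: le_trans ge _.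
    rewrite lerD2l -ebarE'.
    have -> : beta / (4 * (beta + 1)) * gap k = gap k * (beta / 4) / (beta + 1).
      by field; rewrite gt_eqF // addr_gt0.
    rewrite ler_wpM2r ?invr_ge0 ?addr_ge0 ?(ltW b0) //.
    move: gap_gt; rewrite /delta_SI ltr_pdivrMr // => /ltW; lra.
  have th_pos : 0 <= 1 - beta / (4 * (beta + 1)).
    by rewrite subr_ge0 ler_pdivrMr ?mul1r ?mulr_gt0 ?addr_gt0 //; lra.
  apply: (@le_trans _ _ ((1 - beta / (4 * (beta + 1))) ^+ 2)); last first.
    by rewrite lerXn2r // nnegrE // (le_trans th_pos).
  have -> : beta / (4 * (beta + 1)) = beta / (beta + 1) / 4.
    by field; rewrite gt_eqF // addr_gt0.
  have -> : 2 * beta / (3 * (beta + 1)) = beta / (beta + 1) * (2 / 3).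
    by field; rewrite gt_eqF // addr_gt0.
  have : 0 <= beta / (beta + 1) by rewrite divr_ge0 ?addr_ge0 // ltW.
  by move: (beta / _) => p p0; have := sqr_ge0 p; nra.
rewrite ler_pdivlMr //.
(* Since [rho k = mu ^+ 2 / egap k], only the ratio [th] survives. *)
have aVE : a * (egap k ^+ 3 / (2 * gap k ^+ 2)) =
   (1 - beta) ^+ 2 * mu ^+ 2 * th ^+ 2 / (16 * G ^+ 2).
  by rewrite /a /th rkE -/(fh k _) -/(egap k); field; rewrite !gt_eqF.
have : N.+1%:R * (a * (egap k ^+ 3 / (2 * gap k ^+ 2))) <= 1.
  apply: le_trans aN; rewrite mulrA [N.+1%:R * a]mulrC.
  by rewrite ler_wpM2l // mulr_ge0 // ltW.
rewrite aVE mulrA ler_pdivrMr ?mulr_gt0 // mul1r; apply: le_trans.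
by rewrite ler_wpM2l // ler_wpM2l // mulr_ge0 // ?sqr_ge0 // ltW.
Qed.

(** * Termination, geometric decay and the total count *)

Lemma inner_terminates k : reached T k -> delta_SI beta ebar < gap k ->
  reached T k.+1 /\ (odflt 0%N (T k))%:R <= step_bound.
Proof.
move=> rk gap_gt; case Tk : (T k) => [N|] /=; last first.
  (* An infinite loop would perform more steps than the bound permits. *)
  have /(inner_steps_le rk gap_gt) : forall t, (t < (Num.truncn step_bound).+1)%N -> lt_steps T t k.
    by move=> t _; rewrite /lt_steps Tk.
  by rewrite leNgt truncnS_gt.
split; last by apply: inner_steps_le gap_gt _ => // t; rewrite /lt_steps Tk.
move=> j; rewrite ltnS leq_eqVlt => /predU1P[->|]; last exact: rk.
by rewrite Tk.
Qed.

(** [3 * ebar / beta] is the fixed point of the recursion in [gap_contraction]. *)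
Lemma gap_decay k : reached T k ->
  gap k - 3 * ebar / beta <= (1 - beta / 2) ^+ k * (gap 0 - 3 * ebar / beta).
Proof.
have [b0 b1] := andP beta_itv.
have q0 : 0 <= 1 - beta / 2 by lra.
have cE : beta / 2 * (3 * ebar / beta) = 3 * ebar / 2 by field; rewrite gt_eqF.
elim: k => [_|k IH rkS]; first by rewrite expr0 mul1r.
have := ler_wpM2l q0 (IH (reachedW rkS)); rewrite mulrA -exprS; apply: le_trans.
move: cE (gap_contraction rkS); move: (gap k) (gap k.+1) => {IH q0} a b; lra.
Qed.

Lemma accurate_iterate : exists k : nat,
  [/\ reached T k, k%:Z <= K_SI beta (gap 0) ebar, gap k <= delta_SI beta ebar,
      forall j, (j < k)%N -> delta_SI beta ebar < gap j &
      (total_steps T k)%:R <= steps_SI G mu beta (gap 0) ebar].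
Proof.
have [b0 b1] := andP beta_itv.
set delta := delta_SI _ _; set K := `|K_SI beta (gap 0) ebar|%N.
have KE : K%:Z = K_SI beta (gap 0) ebar by rewrite gez0_abs // K_SI_ge0.
have reachedP k : (forall j, (j < k)%N -> delta < gap j) -> reached T k.
  elim: k => [//|k IH] gt_delta.
  by have [] := inner_terminates (IH (fun j jk => gt_delta j (ltnW jk))) (gt_delta k (ltnSn k)).
have ex : exists k, (k <= K)%N && (gap k <= delta).
  apply: contrapT => nex.
  have gt_delta k : (k <= K)%N -> delta < gap k.
    by move=> kK; rewrite ltNge; apply/negP => gk; apply: nex; exists k; rewrite kK.
  have ebar_b : 0 < ebar / beta by rewrite divr_gt0.
  (* The threshold is the fixed point plus the residue [ebar / beta] left after [K] contractions. If
     the initial gap is already below the fixed point, iteration 0 is accurate. *)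
  have dE : delta = ebar / beta + 3 * ebar / beta by rewrite /delta /delta_SI; ring.
  have [gap_le|gap_gt] := leP (gap 0) (3 * ebar / beta).
    have := gt_delta 0%N (leq0n _); rewrite ltNge dE => /negP; apply.
    by rewrite (le_trans gap_le) // lerDr ltW.
  have rK : reached T K by apply: reachedP => j /ltnW; exact: gt_delta.
  have := le_trans (gap_decay rK) (K_SI_contraction beta_itv ebar_gt0 gap_gt).
  by rewrite lerBlDr -dE leNgt gt_delta.
(* For the first accurate iteration, all earlier gaps exceed [delta], so each earlier inner loop
   obeys the step bound. *)
case: (ex_minnP ex) => k /andP[kK gk] kmin.
have gt_delta j : (j < k)%N -> delta < gap j.
  move=> jk; rewrite ltNge; apply/negP => gj.
  have := kmin j; rewrite gj (leq_trans (ltnW jk) kK) => /(_ isT).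
  by rewrite leqNgt jk.
exists k; split=> //; [exact: reachedP|by rewrite -KE lez_nat|].
have bound0 : 0 <= step_bound.
  by apply: ltW; rewrite divr_gt0 ?mulr_gt0 // ?exprn_gt0 // subr_gt0.
rewrite /steps_SI -/step_bound -KE /total_steps natr_sum.
apply: (@le_trans _ _ (\sum_(j < k) step_bound)).
  apply: ler_sum => j _.
  have rj : reached T j by apply: reachedP => i ij; apply: gt_delta; exact: ltn_trans ij _.
  by have [] := inner_terminates rj (gt_delta _ (ltn_ord j)).
rewrite sumr_const card_ord -mulr_natr ler_wpM2l // -pmulrn ler_nat //.
Qed.

End convergence.

Theorem theorem4 (R : realType) (m n r l : nat)
  (d : measure_display) (Xi : measurableType d) (P : probability Xi R)
  (pb : tslp R m n r l Xi) (fstar : R)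
  (f_real : forall z, feasible pb z ->
     P.-integrable setT (fun xi => recourse pb z xi))
  (f_convex : convex_function
     (feasible pb : set (convex_lmodType 'cV[R]_n)) (objective pb P))
  (f_min : exists2 z,
     is_argmin (feasible pb) (objective pb P) z & objective pb P z = fstar)
  (beta : R) (beta_itv : 0 < beta < 1)
  (U : 'cV[R]_n -> Xi -> 'cV[R]_r)
  (smp : nat -> seq Xi) (rho : nat -> R) (x : nat -> nat -> 'cV[R]_n)
  (fb : nat -> nat -> 'cV[R]_n -> R) (T : nat -> option nat)
  (Jg Js : nat -> nat -> pred nat)
  (U_argmax : forall k, reached T k -> forall xi, xi \in smp k ->
     forall z, feasible pb z -> dual_argmax pb z xi (U z xi))
  (run : lshaped_run pb U beta smp rho x fb T Jg Js)
  (D : R)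
  (X_neq0 : feasible pb !=set0)
  (X_diam : forall z z', feasible pb z -> feasible pb z' ->
     enorm (z - z') <= D)
  (eps1 eps2 : R)
  (saa_approx : forall k, reached T k -> forall z, feasible pb z ->
     ((objective pb P z - eps1)%:E <= saa pb (smp k) z <=
      (objective pb P z + eps2)%:E)%E)
  (G : R) (G_gt0 : 0 < G)
  (grad_bound : forall k, reached T k -> forall z, feasible pb z ->
     enorm (saa_grad pb U (smp k) z) <= G)
  (bundle : bundle_assumption pb U smp rho x fb T G)
  (mu : R) (mu_gt0 : 0 < mu) (f_sharp : sharp pb P fstar mu)
  (ebar : R) (ebarE : ebar = (beta + 1) * (eps1 + eps2))
  (ebar_itv : 0 < ebar < 1)
  (rhoE : forall k, reached T k ->
     rho k = mu ^+ 2 / (saa_val pb (smp k) (x k 0%N) - eps2 - fstar)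
     /\ 0 < rho k) :
  let f := objective pb P in
  let gap0 := f (x 0%N 0%N) - fstar in
  [/\ exists k : nat,
        [/\ reached T k,
            (k%:Z <= K_SI beta gap0 ebar)%R,
            f (x k 0%N) - fstar <= delta_SI beta ebar,
            forall j, (j < k)%N ->
              delta_SI beta ebar < f (x j 0%N) - fstar &
            (total_steps T k)%:R <= steps_SI G mu beta gap0 ebar],
      (fun e : R => (K_SI beta gap0 e)%:~R : R^o) =O_ (0^'+)
        (fun e : R => ln e^-1 : R^o) &
      (fun e : R => steps_SI G mu beta gap0 e : R^o) =O_ (0^'+)
        (fun e : R => ln e^-1 : R^o)].
Proof.
move=> f gap0; have [e0 _] := andP ebar_itv.
have X0 : optimal_set pb P fstar !=set0.
  by have [z [Xz _] fz] := f_min; exists z.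
split; last exact: steps_SI_bigO; last exact: K_SI_bigO.
exact: (accurate_iterate X0 beta_itv U_argmax run saa_approx G_gt0 grad_bound
  bundle mu_gt0 f_sharp ebarE e0 rhoE).
Qed.
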